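(* Let $\mathbb K=\mathbb Q_p$, let $\mathbb O\subset\mathbb K$ be the ring of integers, and let $g=\begin{pmatrix} a & b \\ c & d \end{pmatrix}$ be a block matrix of size $\alpha+N$ over $\mathbb K$. For a lattice $R\subset\mathbb K^2$ let $\chi_g(R)\subset\mathbb K^\alpha\oplus\mathbb K^\alpha$ be the set defined in the context. Then: a) The sets $\chi_g(R)$ are lattices. b) If lattices $R,T\subset\mathbb K^2$ are connected by an arrow, then $\chi_g(R)$ and $\chi_g(T)$ are connected by an arrow or coincide. c) The lattice $\chi_g(R)$ depends on the conjugacy class containing $g$ (with respect to conjugation by the matrices $\begin{pmatrix} 1_\alpha & 0 \\ 0 & u \end{pmatrix}$, $u\in\mathrm{GL}(N,\mathbb O)$) and not on $g$ itself. d) $\chi_g(\lambda R)=\lambda\,\chi_g(R)$ for $\lambda\in\mathbb K^\times$.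
   Context: A lattice in $\mathbb K^n$ is a compact $\mathbb O$-submodule $R\subset\mathbb K^n$ such that $\mathbb K\cdot R=\mathbb K^n$ (in other words, $R=\bigoplus_j\mathbb O e_j$ for some basis $e_j$ of $\mathbb K^n$). For lattices $R,T$ in the same space there is an arrow from $R$ to $T$ if $T\supset R\supset pT$. For a lattice $R\subset\mathbb K^2=\mathbb K\oplus\mathbb K$ consider the lattice $R\otimes\mathbb O^N\subset\mathbb K^2\otimes\mathbb K^N=\mathbb K^N\oplus\mathbb K^N$. The set $\chi_g(R)$ consists of all $q\oplus p\in\mathbb K^\alpha\oplus\mathbb K^\alpha$ for which there is $y\oplus x\in R\otimes\mathbb O^N$ (with $y,x\in\mathbb K^N$) satisfying $\begin{pmatrix} q \\ y \end{pmatrix}=\begin{pmatrix} a & b \\ c & d \end{pmatrix}\begin{pmatrix} p \\ x \end{pmatrix}$.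
   Formalization: Part a) is false for general g (for g=1, χ_g(R) is the diagonal, not a lattice), so a) assumes that b and c both have rank α, which is necessary and sufficient for χ_g(R) to be a lattice; b), c), d) hold for all g. *)

(* Defs.v *)
From HB Require Import structures.
From mathcomp Require Import all_boot all_order all_algebra.
From mathcomp Require Import all_classical all_reals all_analysis.

Set Implicit Arguments.
Unset Strict Implicit.
Unset Printing Implicit Defensive.

Import GRing.Theory.
Local Open Scope classical_set_scope.
Local Open Scope ring_scope.

(* The ring of p-adic integers as the inverse limit of the Z/p^n: an element  *)
(* is the sequence of its residues modulo p^n, taken in [0, p^n).  The proof  *)
(* that p is prime is a parameter so that the type is an integral domain.     *)
Record padic_int (p : nat) (p_pr : prime p) := PadicInt {
  residue :> nat -> nat;
  residueP : forall n, residue n = (residue n.+1 %% p ^ n)%N }.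

Section PadicInt.
Variables (p : nat) (p_pr : prime p).
Local Notation Zp := (padic_int p_pr).
Implicit Types x y z : Zp.

HB.instance Definition _ := gen_eqMixin Zp.
HB.instance Definition _ := gen_choiceMixin Zp.

Let p_gt0 : (0 < p)%N. Proof. exact: prime_gt0. Qed.
Let pX_gt0 n : (0 < p ^ n)%N. Proof. by rewrite expn_gt0 p_gt0. Qed.

Lemma padic_intP x y : (forall n, x n = y n) -> x = y.
Proof.
case: x y => [x xP] [y yP] /= exy.
have {exy} exy : x = y by apply/funext.
by subst y; congr PadicInt; exact: Prop_irrelevance.
Qed.

Lemma residue_mod x n : (x n %% p ^ n)%N = x n.
Proof. by rewrite (residueP x n) modn_mod. Qed.

Lemma residue_le x m n : (m <= n)%N -> (x n %% p ^ m)%N = x m.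
Proof.
elim: n => [|n IHn]; first by rewrite leqn0 => /eqP->; rewrite residue_mod.
rewrite leq_eqVlt => /orP[/eqP->|]; first by rewrite residue_mod.
rewrite ltnS => mn; rewrite -(IHn mn) (residueP x n) modn_dvdm //.
exact: dvdn_exp2l.
Qed.

Lemma expnS_dvd n : (p ^ n %| p ^ n.+1)%N.
Proof. by rewrite dvdn_exp2l. Qed.

Lemma padic_nat_subproof (a n : nat) :
  (a %% p ^ n)%N = (a %% p ^ n.+1 %% p ^ n)%N.
Proof. by rewrite modn_dvdm ?expnS_dvd. Qed.
Definition padic_nat a : Zp := PadicInt p_pr (padic_nat_subproof a).

Lemma padic_add_subproof x y n :
  ((x n + y n) %% p ^ n)%N = ((x n.+1 + y n.+1) %% p ^ n.+1 %% p ^ n)%N.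
Proof. by rewrite modn_dvdm ?expnS_dvd // (residueP x n) (residueP y n) modnDm. Qed.
Definition padic_add x y : Zp := PadicInt p_pr (padic_add_subproof x y).

Lemma padic_mul_subproof x y n :
  ((x n * y n) %% p ^ n)%N = ((x n.+1 * y n.+1) %% p ^ n.+1 %% p ^ n)%N.
Proof. by rewrite modn_dvdm ?expnS_dvd // (residueP x n) (residueP y n) modnMm. Qed.
Definition padic_mul x y : Zp := PadicInt p_pr (padic_mul_subproof x y).

(* - x is represented by (p ^ n - 1) * x n to avoid truncated subtraction of  *)
(* residues.                                                                  *)
Lemma padic_opp_subproof x n :
  (((p ^ n).-1 * x n) %% p ^ n)%N =
  (((p ^ n.+1).-1 * x n.+1) %% p ^ n.+1 %% p ^ n)%N.
Proof.
rewrite modn_dvdm ?expnS_dvd // (residueP x n) modnMmr.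
apply/eqP; rewrite -(eqn_modDr (x n.+1)) -!mulSnr !prednK //.
by rewrite modnMr; apply/eqP/esym/eqP; rewrite -/(dvdn _ _) dvdn_mulr // expnS_dvd.
Qed.
Definition padic_opp x : Zp := PadicInt p_pr (padic_opp_subproof x).

Lemma padic_addA : associative padic_add.
Proof. by move=> x y z; apply: padic_intP => n /=; rewrite modnDmr modnDml addnA. Qed.
Lemma padic_addC : commutative padic_add.
Proof. by move=> x y; apply: padic_intP => n /=; rewrite addnC. Qed.
Lemma padic_add0 : left_id (padic_nat 0) padic_add.
Proof. by move=> x; apply: padic_intP => n /=; rewrite mod0n add0n residue_mod. Qed.
Lemma padic_addN : left_inverse (padic_nat 0) padic_opp padic_add.
Proof.
move=> x; apply: padic_intP => n /=.
by rewrite modnDml -mulSnr prednK // modnMr mod0n.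
Qed.

HB.instance Definition _ :=
  GRing.isZmodule.Build Zp padic_addA padic_addC padic_add0 padic_addN.

Lemma padic_mulA : associative padic_mul.
Proof. by move=> x y z; apply: padic_intP => n /=; rewrite modnMmr modnMml mulnA. Qed.
Lemma padic_mulC : commutative padic_mul.
Proof. by move=> x y; apply: padic_intP => n /=; rewrite mulnC. Qed.
Lemma padic_mul1 : left_id (padic_nat 1) padic_mul.
Proof. by move=> x; apply: padic_intP => n /=; rewrite modnMml mul1n residue_mod. Qed.
Lemma padic_mulD : left_distributive padic_mul padic_add.
Proof. by move=> x y z; apply: padic_intP => n /=; rewrite modnMml modnDm mulnDl. Qed.
Lemma padic_oneN0 : padic_nat 1 != 0.
Proof.
apply/eqP => /(congr1 (fun x : Zp => x 1%N)) /=.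
by rewrite expn1 mod0n modn_small // prime_gt1.
Qed.

HB.instance Definition _ := GRing.Zmodule_isComNzRing.Build Zp
  padic_mulA padic_mulC padic_mul1 padic_mulD padic_oneN0.

Definition padic_unit : pred Zp := fun x => `[< exists y, y * x = 1 >].
Definition padic_inv x : Zp := xget x [set y | y * x = 1].

Lemma padic_mulV : {in padic_unit, left_inverse 1 padic_inv *%R}.
Proof. by move=> x /asboolP[y yx]; rewrite /padic_inv; case: xgetP => // /(_ y). Qed.
Lemma padic_unitP x y : y * x = 1 -> padic_unit x.
Proof. by move=> yx; apply/asboolP; exists y. Qed.
Lemma padic_inv_out : {in [predC padic_unit], padic_inv =1 id}.
Proof.
move=> x /asboolPn nx; rewrite /padic_inv; case: xgetP => // y _ /= yx.
by case: nx; exists y.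
Qed.

HB.instance Definition _ :=
  GRing.ComNzRing_hasMulInverse.Build Zp padic_mulV padic_unitP padic_inv_out.

Lemma padic_mulf_eq0 x y : x * y = 0 -> (x == 0) || (y == 0).
Proof.
move=> xy0; apply: contraPT xy0 => /norP[/eqP xN0 /eqP yN0].
have nz z : z <> 0 -> exists n, z n != 0%N.
  move=> zN0; apply: contra_notP zN0 => /forallNP zE.
  by apply: padic_intP => n; rewrite /= mod0n; apply/eqP/negPn/negP/zE.
have [m xm] := nz x xN0; have [n yn] := nz y yN0.
have dvd z i : z i != 0%N -> forall j, (i <= j)%N -> (0 < z j)%N /\ (logn p (z j) < i)%N.
  move=> zi j ij; have zj : (0 < z j)%N.
    rewrite lt0n; apply: contraNneq zi => zj0.
    by rewrite -(residue_le z ij) zj0 mod0n.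
  split=> //; rewrite ltnNge; apply: contra zi => zij.
  by rewrite -(residue_le z ij) -/(dvdn _ _) pfactor_dvdn.
have [x0 xl] := dvd x m xm _ (leq_addr n m).
have [y0 yl] := dvd y n yn _ (leq_addl m n).
move=> /(congr1 (fun z : Zp => z (m + n)%N)) /=; rewrite mod0n => /eqP.
rewrite -/(dvdn _ _) pfactor_dvdn ?muln_gt0 ?x0 // lognM // leqNgt.
by rewrite -addnS leq_add // ltnW.
Qed.

HB.instance Definition _ := GRing.ComUnitRing_isIntegral.Build Zp padic_mulf_eq0.

End PadicInt.

Definition padic (p : nat) (p_pr : prime p) := {fraction (padic_int p_pr)}.

HB.instance Definition _ (p : nat) (p_pr : prime p) :=
  GRing.Field.on (padic p_pr).

Section PadicTopology.
Variables (p : nat) (p_pr : prime p).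
Local Notation O := (padic_int p_pr).
Local Notation K := (padic p_pr).

Definition ofO (z : O) : K := FracField.tofrac z.

HB.instance Definition _ := GRing.RMorphism.copy ofO (@FracField.tofrac O).

(* The p-adic uniformity: x and y are close when x - y lies in p ^ k O.       *)
Definition padic_near (k : nat) : set (K * K) :=
  [set xy | exists z : O, xy.1 - xy.2 = ofO (p%:R ^+ k * z)].

Definition padic_ent : set_system (K * K) := filter_from setT padic_near.

Lemma padic_near_le k l : (k <= l)%N -> padic_near l `<=` padic_near k.
Proof.
move=> kl xy [z zE]; exists (p%:R ^+ (l - k) * z).
by rewrite zE mulrA -exprD subnKC.
Qed.

Lemma padic_ent_filter : Filter padic_ent.
Proof.
apply: filter_from_filter => [|k l _ _]; first by exists 0%N.
by exists (maxn k l) => // xy xyP; split; apply: padic_near_le xyP;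
  rewrite ?leq_maxl ?leq_maxr.
Qed.

Lemma padic_ent_diagonal A : padic_ent A -> diagonal `<=` A.
Proof.
move=> [k _ kA] [x y] xy; apply: kA; have -> : x = y := xy.
by exists 0; rewrite /= subrr mulr0 rmorph0.
Qed.

Lemma padic_ent_inv A : padic_ent A -> padic_ent A^-1%relation.
Proof.
move=> [k _ kA]; exists k => // -[x y] [z /= zE]; apply: kA; exists (- z) => /=.
by rewrite mulrN rmorphN /= -zE opprB.
Qed.

Lemma padic_ent_split A :
  padic_ent A -> exists2 B, padic_ent B & (B \; B `<=` A)%relation.
Proof.
move=> [k _ kA]; exists (padic_near k); first by exists k.
move=> [x y] [t [z /= zE] [z' /= z'E]]; apply: kA; exists (z + z') => /=.
by rewrite mulrDr rmorphD /= -zE -z'E addrA subrK.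
Qed.

HB.instance Definition _ := isUniform.Build K
  padic_ent_filter padic_ent_diagonal padic_ent_inv padic_ent_split.

End PadicTopology.

Section Lattices.
Variables (p : nat) (p_pr : prime p).
Local Notation O := (padic_int p_pr).
Local Notation K := (padic p_pr).

Definition is_submodule n (R : set 'cV[K]_n) : Prop :=
  [/\ R 0, (forall v w, R v -> R w -> R (v + w)) &
      (forall (a : O) v, R v -> R (ofO a *: v))].

(* 'cV[K]_n carries the product topology.                                     *)
Definition is_lattice n (R : set 'cV[K]_n) : Prop :=
  [/\ is_submodule R, compact R &
      [set l *: v | l in [set: K] & v in R] = setT].

Definition scale_set n (l : K) (R : set 'cV[K]_n) : set 'cV[K]_n :=
  [set l *: v | v in R].

Definition arrow n (R T : set 'cV[K]_n) : Prop :=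
  R `<=` T /\ scale_set p%:R T `<=` R.

Definition connected_by_arrow n (R T : set 'cV[K]_n) : Prop :=
  arrow R T \/ arrow T R.

(* The pure tensor r (x) e in K^2 (x) K^N = K^N (+) K^N.                      *)
Definition tens N (r : 'cV[K]_2) (e : 'cV[K]_N) : 'cV[K]_(N + N) :=
  col_mx (r 0 0 *: e) (r 1 0 *: e).

(* R (x) O^N inside K^N (+) K^N.                                              *)
Definition tensO N (R : set 'cV[K]_2) : set 'cV[K]_(N + N) :=
  [set w | exists (m : nat) (r : 'I_m -> 'cV[K]_2) (e : 'I_m -> 'cV[O]_N),
    (forall i, R (r i)) /\ w = \sum_i tens (r i) (map_mx (@ofO p p_pr) (e i))].

Definition chi alpha N (g : 'M[K]_(alpha + N)) (R : set 'cV[K]_2) :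
    set 'cV[K]_(alpha + alpha) :=
  [set w | exists (q r : 'cV[K]_alpha) (y x : 'cV[K]_N),
    [/\ w = col_mx q r, tensO R (col_mx y x) &
        col_mx q y = g *m col_mx r x]].

(* g = (a b; c d) with b : K^N -> K^alpha onto and c : K^alpha -> K^N         *)
(* injective.  By chi_lattice_full_rank below, chi g R is never a           *)
(* lattice without this, e.g. for g = 1 and alpha > 0: the claim that chi g R *)
(* is a lattice has to be restricted to such g.                               *)
Definition full_rank_corners alpha N (g : 'M[K]_(alpha + N)) : Prop :=
  \rank (ursubmx g) = alpha /\ \rank (dlsubmx g) = alpha.

(* Conjugation by diag(1, u) with u in GL(N, O).                              *)
Definition diag_GLO alpha N (u : 'M[O]_N) : 'M[K]_(alpha + N) :=
  block_mx 1%:M 0 0 (map_mx (@ofO p p_pr) u).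

Definition conjugate_GLO alpha N (g g' : 'M[K]_(alpha + N)) : Prop :=
  exists2 u : 'M[O]_N, u \in unitmx &
    g' = diag_GLO alpha u *m g *m invmx (diag_GLO alpha u).

Lemma ofO_inj : injective (@ofO p p_pr).
Proof. by move=> x y /eqP; rewrite tofrac_eq => /eqP. Qed.

Lemma padic_denom (x : K) :
  exists2 d : O, d != 0 & exists z : O, ofO d * x = ofO z.
Proof.
elim/quotW: x => -[[a b] /= bN0]; exists b => //; exists a.
rewrite /ofO; unlock FracField.tofrac; rewrite -[LHS]FracField.pi_mul.
apply/eqmodP; rewrite /= FracField.equivfE /FracField.mulf /=.
by rewrite !numden_Ratio ?oner_neq0 //= ?mul1r ?mulr1 // mulrC.
Qed.

Lemma compact_bounded n (A : set 'cV[K]_n) : compact A ->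
  exists2 d : O, d != 0 &
    forall v, A v -> forall i, exists z : O, ofO d * v i 0 = ofO z.
Proof.
pose F : set_system O := filter_from [set d | d != 0]
  (fun d => [set d' | exists e, d' = e * d]).
have FF : Filter F.
  apply: filter_from_filter; first by exists 1; exact: oner_neq0.
  move=> d d' dN0 d'N0; exists (d * d'); first by rewrite /= mulf_neq0.
  move=> _ [e ->]; split; last by exists (e * d); rewrite mulrA.
  by exists (e * d'); rewrite mulrAC mulrA.
move=> /compact_near_coveringP /(_ O F
  (fun d v => forall i, exists z : O, ofO d * v i 0 = ofO z) FF).
move=> H; have [|d dN0 dA] := H; last first.
  by exists d => // v Av; apply: (dA d) => //; exists 1; rewrite mul1r.
move=> v _.
pose d i := s2val (cid2 (padic_denom (v i 0))).
have dN0 i : d i != 0 by rewrite /d; case: cid2.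
have dE i : exists z : O, ofO (d i) * v i 0 = ofO z by rewrite /d; case: cid2.
exists ([set w : 'cV[K]_n | forall i, exists z : O, w i 0 - v i 0 = ofO z],
        [set d' | exists e, d' = e * \prod_i d i]); last first.
  move=> [w _] /= [wP [e ->]] i; have [z zE] := wP i; have [z' z'E] := dE i.
  rewrite (bigD1 i) //= mulrCA; set c := e * _; exists (c * (d i * z + z')).
  rewrite -[w i 0](subrK (v i 0)) zE [d i * c]mulrC !rmorphM rmorphD rmorphM /=.
  by rewrite -z'E -mulrA -mulrDr.
split; last by exists (\prod_i d i) => //=; apply/prodf_neq0.
exists (fun i j => [set t | exists z : O, t - v i j = ofO z]) => [i j|w wP i]; last exact: wP.
exists (@padic_near p p_pr 0); first by exists 0%N.
move=> t /xsectionP [z /= zE]; exists (- z).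
by rewrite rmorphN /= -[z]mul1r -(expr0 p%:R) -zE opprB.
Qed.

Lemma padic_natE a : a%:R = padic_nat p_pr a.
Proof.
elim: a => // a IHa; rewrite -addn1 natrD IHa.
by apply: padic_intP => n /=; rewrite modnDm.
Qed.

Lemma padic_prime_nonunit (z : O) : p%:R * z != 1.
Proof.
rewrite padic_natE; apply/eqP => /(congr1 (fun x : O => x 1%N)) /=.
by rewrite expn1 modnn mul0n mod0n modn_small // prime_gt1.
Qed.

Lemma padic_prime_neq0 : p%:R != 0 :> O.
Proof.
rewrite padic_natE; apply/eqP => /(congr1 (fun x : O => x 2%N)) /=.
rewrite mod0n modn_small; first by move=> p0; move: p_pr; rewrite p0.
by rewrite -{1}[p]expn1 ltn_exp2l // prime_gt1.
Qed.

Lemma tensO0 N (R : set 'cV[K]_2) : R 0 -> @tensO N R 0.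
Proof.
move=> R0; exists 0%N, (fun=> 0), (fun=> 0).
by rewrite big_ord0.
Qed.

Lemma chi_lattice_full_rank alpha N (g : 'M[K]_(alpha + N))
    (R : set 'cV[K]_2) :
  is_submodule R -> is_lattice (chi g R) -> full_rank_corners g.
Proof.
move=> [R0 _ _] [_ chi_cpt chi_span].
have gE (q r : 'cV[K]_alpha) (y x : 'cV[K]_N) :
    col_mx q y = g *m col_mx r x ->
    q = ulsubmx g *m r + ursubmx g *m x /\ y = dlsubmx g *m r + drsubmx g *m x.
  by rewrite -{1}[g]submxK mul_block_col => /eq_col_mx.
split.
  apply/eqP; rewrite -/(row_free _) -kermx_eq0; apply/rowV0P => u /sub_kermxP ub0.
  apply/rowP => i; rewrite mxE.
  have : [set: 'cV[K]_(alpha + alpha)] (col_mx (delta_mx i 0) 0) by [].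
  rewrite -chi_span => -[l _ [_ [q [r [y [x [-> _ /gE[qE _]]]]]]]].
  rewrite scale_col_mx => /eq_col_mx[lq lr].
  have -> : u 0 i = (u *m delta_mx i 0 : 'M[K]_(1,1)) 0 0.
    rewrite mxE (bigD1 i) //= big1 ?addr0 ?mxE ?eqxx ?mulr1 // => j ji.
    by rewrite mxE (negPf ji) mulr0.
  rewrite -lq qE scalerDr mulmxDr !scalemxAr lr mulmx0 mulmx0 add0r.
  by rewrite mulmxA ub0 mul0mx mxE.
apply/eqP; rewrite -mxrank_tr -/(row_free _) -kermx_eq0; apply/rowV0P => u /sub_kermxP uc0.
apply/trmx_inj; rewrite trmx0; apply/eqP/negPn/negP => /cV0Pn[i uN0].
have [d dN0 dP] := compact_bounded chi_cpt.
have line l : chi g R (l *: col_mx (ulsubmx g *m u^T) u^T).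
  exists (l *: (ulsubmx g *m u^T)), (l *: u^T), 0, 0.
  split; first by rewrite scale_col_mx.
    by rewrite col_mx0; exact: tensO0.
  rewrite -{2}[g]submxK mul_block_col !mulmx0 !addr0 -!scalemxAr.
  by congr col_mx; rewrite -[dlsubmx g]trmxK -trmx_mul uc0 trmx0 scaler0.
have [z] := dP _ (line (ofO (p%:R * d) * u^T i 0)^-1) (rshift alpha i).
rewrite mxE col_mxEd rmorphM /= => zE; have := padic_prime_nonunit z.
rewrite -(inj_eq ofO_inj) rmorphM rmorph1 /= -zE => /negP[].
have dK : ofO d != 0 by rewrite -(rmorph0 (@ofO p p_pr)) (inj_eq ofO_inj).
have pK : ofO (p%:R : O) != 0.
  by rewrite -(rmorph0 (@ofO p p_pr)) (inj_eq ofO_inj) padic_prime_neq0.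
by rewrite [_^-1 * _]mulrC !mulrA mulfV // !mulf_neq0.
Qed.

End Lattices.

(* Main.v *)
(* A submodule of K^n is a lattice iff it is squeezed between two multiples of *)
(* O^n: compactness then follows because an ultrafilter selects a residue      *)
(* modulo each p^k.  A vector y (+) x lies in R (x) O^N iff every pair         *)
(* (y_j, x_j) lies in R, so R (x) O^N is squeezed as well.  As c has a left    *)
(* inverse c' and b a right inverse b', r = c' (y - d x) and q = a r + b x     *)
(* bound chi_g(R), while x = b' (q - a r) and y = c r + d x show that          *)
(* chi_g(R) contains a multiple of O^(2 alpha).                                *)
Require Import Defs.
From mathcomp Require Import all_boot all_order all_algebra.
From mathcomp Require Import cyclic.
From mathcomp Require Import all_classical all_reals all_analysis.

Set Implicit Arguments.
Unset Strict Implicit.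
Unset Printing Implicit Defensive.

Import GRing.Theory.
Local Open Scope classical_set_scope.
Local Open Scope ring_scope.

(** The relation defining chi_g(R) is linear, so everything reduces to how R (x) O^N varies with R.
    Monotonicity and homogeneity in R ([sub_chi], [chi_scale]) give d), and also b), since an arrow
    is a pair of inclusions, one of them after scaling by p. The map 1 (x) u preserves R (x) O^N for
    integral u, so conjugating g by diag(1, u) only replaces (y, x) by (u y, u x), which gives c)
    ([conjugate_chi]). For a), with b onto and c injective, (q, r) is a linear function of (y, x),
    and a suitable (y, x) can be chosen linearly in (q, r); this gives [chi_bounded] and
    [chi_absorbing], and [bounded_absorbing_lattice] concludes. *)

(** * Divisibility and ultrafilter limits in the p-adic integers *)

Section PadicDivisibility.
Variables (p : nat) (p_pr : prime p).
Local Notation O := (padic_int p_pr).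
Implicit Types x y z : O.

Lemma padic_ltn_residue x k : (x k < p ^ k)%N.
Proof. by rewrite -(residue_mod x k) ltn_mod expn_gt0 prime_gt0. Qed.

(** The quotient has n-th residue x_(n+k) / p^k: the shift by k makes up for the k digits lost in
    the division. *)
Lemma padic_residue0_dvd k x : x k = 0%N -> exists z, x = p%:R ^+ k * z.
Proof.
move=> xk0; pose f n := (x (n + k)%N %/ p ^ k)%N.
have fP n : f n = (f n.+1 %% p ^ n)%N.
  by rewrite /f modn_divl -expnD -(@residue_le _ _ x (n + k) (n.+1 + k)) ?leq_add2r.
exists (PadicInt p_pr fP); rewrite -natrX padic_natE.
apply: padic_intP => n; rewrite /= modnMml /f mulnC divnK.
  by rewrite residue_le // leq_addr.
by rewrite /dvdn residue_le ?leq_addl // xk0.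
Qed.

Lemma padic_residue_eq_dvd k x y :
  x k = y k -> exists z, x - y = p%:R ^+ k * z.
Proof.
move=> xy; apply: padic_residue0_dvd.
(* The residue of x - y at k depends only on those of x and y at k, so it equals that of y - y. *)
have /(congr1 (fun z : O => z k)) /= := subrr y.
by rewrite /= xy mod0n.
Qed.

Lemma padic_residue_dvd k z : (p%:R ^+ k * z : O) k = 0%N.
Proof. by rewrite -natrX padic_natE /= modnn mul0n mod0n. Qed.

(** By Euler's theorem x_n^(phi(p^n) - 1) inverts x_n modulo p^n; these inverses cohere because an
    inverse modulo p^n is unique. *)
Lemma padic_residue1_unit x : x 1%N != 0%N -> exists y, y * x = 1.
Proof.
move=> x1; have co n : coprime (x n) (p ^ n).
  case: n => [|n]; first by rewrite expn0 coprimen1.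
  rewrite coprime_sym coprimeXl // prime_coprime //.
  by apply: contra x1 => px; rewrite -(@residue_le _ _ x 1 n.+1).
pose h n := (x n ^ (totient (p ^ n)).-1)%N.
have hx n : (h n * x n = 1 %[mod p ^ n])%N.
  rewrite /h -expnSr prednK ?totient_gt0 ?expn_gt0 ?prime_gt0 //.
  exact: Euler_exp_totient.
have hP n : (h n %% p ^ n = h n.+1 %% p ^ n.+1 %% p ^ n)%N.
  rewrite modn_dvdm ?dvdn_exp2l //.
  have hx' : (h n.+1 * x n = 1 %[mod p ^ n])%N.
    rewrite (residueP x n) modnMmr -(modn_dvdm (h n.+1 * _) (expnS_dvd p n)) hx.
    by rewrite modn_dvdm // expnS_dvd.
  (* Modulo p^n, h n = h n * (h n.+1 * x n) = h n.+1 * (h n * x n) = h n.+1. *)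
  rewrite -[h n in LHS]muln1 -modnMmr -hx' modnMmr mulnCA -modnMmr hx modnMmr.
  by rewrite muln1.
exists (PadicInt p_pr hP); apply: padic_intP => n.
by rewrite /= modnMml hx.
Qed.

(** Factors p are split off until a unit remains; a residue x_n that is nonzero bounds their number.
    This compares arbitrary nonzero scalars with the powers of p that define the topology. *)
Lemma padic_dvd_prime_exp x : x != 0 -> exists k z, p%:R ^+ k = x * z.
Proof.
move=> xN0; have [n] : exists n, x n != 0%N.
  apply: contrapT => /forallNP x0; case/eqP: xN0.
  by apply: padic_intP => n; rewrite /= mod0n; apply/eqP/negPn/negP/x0.
elim: n x {xN0} => [|n IHn] x xn.
  by move: (padic_ltn_residue x 0); rewrite expn0 ltnS leqn0 (negPf xn).
have [x1|/padic_residue1_unit[z zx]] := eqVneq (x 1%N) 0%N; last first.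
  by exists 0%N, z; rewrite mulrC zx.
have [y xE] := padic_residue0_dvd x1.
have [|k [z zE]] := IHn y.
  apply: contraNneq xn => /padic_residue0_dvd[z yE].
  by rewrite xE yE mulrA -exprD padic_residue_dvd.
by exists k.+1, z; rewrite exprS zE xE expr1 mulrA.
Qed.

Lemma ultra_nat_bounded T (F : set_system T) (FU : UltraFilter F)
    (f : T -> nat) m : F [set t | (f t < m)%N] -> exists c, F [set t | f t = c].
Proof.
elim: m => [|m IHm] Fm.
  by have [t] := @filter_ex _ _ ultra_proper _ Fm.
have [|Fc] := in_ultra_setVsetC [set t | f t = m] FU; first by exists m.
apply: IHm; apply: filterS2 Fm Fc => t /=.
by rewrite ltnS leq_eqVlt => /orP[/eqP|].
Qed.

(** There are finitely many residues modulo p^k, so F selects one for each k; the selections cohere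
    because any two sets of F meet. *)
Lemma padic_ultra_limit T (F : set_system T) (FU : UltraFilter F) (f : T -> O) :
  exists z, forall k, F [set t | f t k = z k].
Proof.
have /choice[c cP] k : exists c, F [set t | f t k = c].
  apply: (@ultra_nat_bounded _ _ _ (fun t => f t k) (p ^ k)).
  by apply: filterS filterT => t _ /=; exact: padic_ltn_residue.
have cE k : c k = (c k.+1 %% p ^ k)%N.
  have [t /= [<- <-]] := @filter_ex _ _ ultra_proper _ (filterI (cP k) (cP k.+1)).
  exact: residueP.
by exists (PadicInt p_pr cE).
Qed.

End PadicDivisibility.

(** * Lattices as submodules squeezed between multiples of O^n *)

Section Lattices.
Variables (p : nat) (p_pr : prime p).
Local Notation O := (padic_int p_pr).
Local Notation K := (padic p_pr).
Local Notation ofO := (@ofO p p_pr).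

Lemma ofO_eq0 (x : O) : (ofO x == 0) = (x == 0).
Proof. by rewrite -(rmorph0 ofO) (inj_eq (@ofO_inj p p_pr)). Qed.

Definition integral_mx m n (A : 'M[K]_(m, n)) : Prop :=
  exists B : 'M[O]_(m, n), A = map_mx ofO B.

Lemma integral_mxP m n (A : 'M[K]_(m, n)) :
  integral_mx A <-> forall i j, exists z, A i j = ofO z.
Proof.
split=> [[B ->] i j|AO]; first by exists (B i j); rewrite mxE.
have /choice[f fP] (ij : 'I_m * 'I_n) : exists z, A ij.1 ij.2 = ofO z by exact: AO.
exists (\matrix_(i, j) f (i, j)).
by apply/matrixP => i j; rewrite !mxE -fP.
Qed.

Lemma integral_mulmx m n q (A : 'M[K]_(m, n)) (B : 'M[K]_(n, q)) :
  integral_mx A -> integral_mx B -> integral_mx (A *m B).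
Proof. by move=> [A' ->] [B' ->]; exists (A' *m B'); rewrite map_mxM. Qed.

Lemma integral_mx_denom m n (A : 'M[K]_(m, n)) :
  exists2 d : O, d != 0 & integral_mx (ofO d *: A).
Proof.
have /choice[d dP] (ij : 'I_m * 'I_n) :
    exists d : O, d != 0 /\ exists z, ofO d * A ij.1 ij.2 = ofO z.
  by have [d dN0 dP] := padic_denom (A ij.1 ij.2); exists d.
exists (\prod_ij d ij); first by apply/prodf_neq0 => ij _; have [] := dP ij.
apply/integral_mxP => i j; have [_ [z zE]] := dP (i, j).
rewrite mxE (bigD1 (i, j)) //= [d _ * _]mulrC rmorphM /= -mulrA zE.
by eexists; rewrite -rmorphM.
Qed.

Section Submodule.
Variables (n : nat) (M : set 'cV[K]_n).
Hypothesis M_sub : is_submodule M.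

Lemma submodule_sum (I : finType) (f : I -> 'cV[K]_n) :
  (forall i, M (f i)) -> M (\sum_i f i).
Proof. by case: M_sub => M0 MD _ Mf; elim/big_ind: _. Qed.

Lemma submodule_sub v w : M v -> M w -> M (v - w).
Proof.
case: M_sub => _ MD MZ Mv Mw; apply: MD => //.
by rewrite -scaleN1r -(rmorphN1 ofO); exact: MZ.
Qed.

(** This and the next definition are the two halves of e O^n <= M <= d^-1 O^n. Constants in O
    suffice because [padic_denom] clears any scalar of K. *)
Definition submodule_bounded : Prop :=
  exists2 d : O, d != 0 & forall v, M v -> integral_mx (ofO d *: v).

Definition submodule_absorbing : Prop :=
  exists2 e : O, e != 0 & forall v, integral_mx v -> M (ofO e *: v).

(** Boundedness gives the coordinates a common denominator, so an ultrafilter on M has a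
    coordinatewise limit; absorption makes M closed, hence the limit stays in M. *)
Lemma submodule_compact :
  submodule_bounded -> submodule_absorbing -> compact M.
Proof.
move=> [d dN0 dP] [e eN0 eP]; rewrite compact_ultra => F FU FM.
have FF : Filter F by exact: ultra_proper.
(* The numerator of v_i over d; the default 0 can occur only outside M, which F ignores. *)
pose f (i : 'I_n) (v : 'cV[K]_n) := xget 0 [set z : O | ofO d * v i 0 = ofO z].
have fE v i : M v -> ofO d * v i 0 = ofO (f i v).
  move=> /dP /integral_mxP /(_ i 0)[z]; rewrite mxE => zE.
  by rewrite /f; case: xgetP => [//|/(_ z)].
have /choice[z zP] i : exists z : O, forall k, F [set v | f i v k = z k].
  exact: (padic_ultra_limit FU).
pose w : 'cV[K]_n := \col_i (ofO (z i) / ofO d).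
(* Congruence modulo p ^ k of the numerators forces proximity in K because    *)
(* d * c divides some power of p.                                             *)
have close (c : O) : c != 0 ->
    F [set v | M v /\ forall i, exists t : O, v i 0 - w i 0 = ofO (c * t)].
  move=> cN0; have [k [t tE]] := padic_dvd_prime_exp (mulf_neq0 dN0 cN0).
  have Fk := @filter_forall _ _ (fun i => [set v | f i v k = z i k]) F FF
    (fun i => zP i k).
  apply: filterS2 FM Fk => v Mv vk; split=> // i.
  have [s sE] := @padic_residue_eq_dvd _ _ k (f i v) (z i) (vk i).
  exists (t * s); have dK : ofO d != 0 by rewrite ofO_eq0.
  apply: (mulfI dK); rewrite mulrBr fE // mxE mulrCA divff // mulr1 -rmorphB sE.
  by rewrite tE rmorphM !rmorphM /= !mulrA.
exists w; split.
  (* Some v in M satisfies v - w in e O^n, which lies in M, so w = v - (v - w) is in M. *)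
  have [v [Mv vw]] := @filter_ex _ _ ultra_proper _ (close e eN0).
  rewrite -(subKr v w); apply: submodule_sub => //.
  have -> : v - w = ofO e *: ((ofO e)^-1 *: (v - w)).
    by rewrite scalerA divff ?scale1r // ofO_eq0.
  apply: eP; apply/integral_mxP => i j; rewrite ord1 !mxE.
  have [t] := vw i; rewrite !mxE => ->; exists t.
  by rewrite rmorphM mulKf // ofO_eq0.
move=> A [P wP PA]; apply: filterS PA _.
have /choice[k kP] i : exists k, forall x : K,
    (exists t : O, x - w i 0 = ofO (p%:R ^+ k * t)) -> P i 0 x.
  have := wP i 0; rewrite -nbhs_entourageE => -[B [k _ kB] BP].
  exists k => x [t tE]; apply: BP; apply/xsectionP/kB; exists (- t).
  by rewrite mulrN rmorphN /= -tE opprB.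
(* The sum of the k_i is at least each k_i, so one power of p serves all coordinates. *)
have pN0 : p%:R ^+ (\sum_i k i)%N != 0 :> O.
  by rewrite expf_neq0 // padic_prime_neq0.
apply: filterS (close _ pN0) => v [_ vw] i j.
rewrite ord1; apply: kP; have [t tE] := vw i.
by exists (p%:R ^+ (\sum_(j | j != i) k j)%N * t); rewrite tE (bigD1 i) //= exprD mulrA.
Qed.

End Submodule.

(** Spanning puts a nonzero O-multiple of each basis vector in M; the product of these multipliers
    works for all of O^n. *)
Lemma lattice_absorbing n (M : set 'cV[K]_n) :
  is_lattice M -> submodule_absorbing M.
Proof.
move=> [M_sub _ M_span]; have [M0 MD MZ] := M_sub.
have /choice[e eP] (i : 'I_n) :
    exists e : O, e != 0 /\ M (ofO e *: delta_mx i 0).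
  have : [set: 'cV[K]_n] (delta_mx i 0) by [].
  rewrite -M_span => -[l _ [v Mv lv]].
  have lN0 : l != 0.
    apply/negP => /eqP l0; move/colP: lv => /(_ i); rewrite l0 scale0r !mxE !eqxx.
    by move/eqP; rewrite eq_sym oner_eq0.
  (* As v = l^-1 delta_i, clearing the denominator of l^-1 gives d v = e delta_i with e in O. *)
  have [d dN0 [e eE]] := padic_denom l^-1.
  exists e; split; last by rewrite -eE -lv scalerA mulfVK //; exact: MZ.
  by rewrite -ofO_eq0 -eE mulf_neq0 ?invr_eq0 ?ofO_eq0.
exists (\prod_i e i) => [|_ [B ->]]; first by apply/prodf_neq0 => i _; have [] := eP i.
have -> : map_mx ofO B = \sum_i ofO (B i 0) *: delta_mx i 0.
  apply/colP => i; rewrite summxE (bigD1 i) //= big1 => [|j ji].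
    by rewrite !mxE !eqxx mulr1 addr0.
  by rewrite !mxE eq_sym (negPf ji) mulr0.
rewrite scaler_sumr; apply: submodule_sum => // i.
have -> : ofO (\prod_j e j) *: (ofO (B i 0) *: delta_mx i 0) =
  ofO (\prod_(j | j != i) e j * B i 0) *: (ofO (e i) *: delta_mx i 0) :> 'cV[K]_n.
  by rewrite (bigD1 i) //= !scalerA -!rmorphM [e i * _]mulrC [in LHS]mulrAC.
by apply: MZ; have [] := eP i.
Qed.

Lemma lattice_bounded n (M : set 'cV[K]_n) : is_lattice M -> submodule_bounded M.
Proof.
move=> [_ /Defs.compact_bounded[d dN0 dP] _]; exists d => // v Mv.
by apply/integral_mxP => i j; rewrite ord1 mxE; exact: dP.
Qed.

Lemma bounded_absorbing_lattice n (M : set 'cV[K]_n) :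
  is_submodule M -> submodule_bounded M -> submodule_absorbing M -> is_lattice M.
Proof.
move=> M_sub M_bnd M_abs; split=> //; first exact: submodule_compact.
apply/seteqP; split=> // v _; have [e eN0 eP] := M_abs.
have [d dN0 dv] := integral_mx_denom v.
exists (ofO (e * d))^-1 => //; exists (ofO e *: (ofO d *: v)); first exact: eP.
by rewrite [ofO e *: _]scalerA -rmorphM scalerA mulVf ?scale1r // ofO_eq0 mulf_neq0.
Qed.

(** * The lattice R (x) O^N in coordinates *)

Section TensorLattice.
Variable N : nat.

(** The j-th component under the identification of K^2 (x) K^N with (K^2)^N. *)
Definition coord_pair (w : 'cV[K]_(N + N)) (j : 'I_N) : 'cV[K]_2 :=
  \col_i w (if i == 0 then lshift N j else rshift N j) 0.

Lemma coord_pair_tens (r : 'cV[K]_2) (e : 'cV[K]_N) j :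
  coord_pair (tens r e) j = e j 0 *: r.
Proof.
apply/colP => i; rewrite !mxE mulrC; case: ifPn => [/eqP->|i0].
  by rewrite (unsplitK (inl j)) mxE.
have -> : i = 1 by apply/val_inj; case: i i0 => -[|[|]].
by rewrite (unsplitK (inr j)) mxE.
Qed.

(** O^N is free on the standard basis: r (x) e has j-th component e_j r, and conversely w is the sum
    of its components tensored with the basis vectors. *)
Lemma tensOP (R : set 'cV[K]_2) (w : 'cV[K]_(N + N)) : is_submodule R ->
  tensO R w <-> forall j, R (coord_pair w j).
Proof.
move=> R_sub; have [R0 RD RZ] := R_sub; split=> [[m [r [e [Rr ->]]]] j|Rw].
  have -> : coord_pair (\sum_i tens (r i) (map_mx ofO (e i))) j =
      \sum_i ofO (e i j 0) *: r i.
    transitivity (\sum_i coord_pair (tens (r i) (map_mx ofO (e i))) j).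
      by apply/colP => k; rewrite mxE !summxE; apply: eq_bigr => i _; rewrite [RHS]mxE.
    by apply: eq_bigr => i _; rewrite coord_pair_tens mxE.
  by apply: submodule_sum => // i; exact: RZ.
exists N, (coord_pair w), (fun j => delta_mx j 0); split=> //.
have delta_sum (f : 'I_N -> K) :
    \sum_j f j *: map_mx ofO (delta_mx j 0) = \col_j f j :> 'cV[K]_N.
  apply/colP => i; rewrite summxE (bigD1 i) //= big1 => [|j ji].
    by rewrite !mxE !eqxx rmorph1 mulr1 addr0.
  by rewrite !mxE eq_sym (negPf ji) rmorph0 mulr0.
have -> (f h : 'I_N -> 'cV[K]_N) :
    \sum_j col_mx (f j) (h j) = col_mx (\sum_j f j) (\sum_j h j).
  rewrite -[LHS]vsubmxK !linear_sum; congr col_mx; apply: eq_bigr => j _ /=.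
    by rewrite col_mxKu.
  by rewrite col_mxKd.
rewrite !delta_sum -[LHS]vsubmxK.
by congr col_mx; apply/colP => j; rewrite !mxE.
Qed.

Lemma tensO_submodule (R : set 'cV[K]_2) :
  is_submodule R -> is_submodule (@tensO p p_pr N R).
Proof.
move=> R_sub; have [R0 RD RZ] := R_sub; split; first exact: tensO0.
  move=> v w /(tensOP _ R_sub) Rv /(tensOP _ R_sub) Rw; apply/(tensOP _ R_sub) => j.
  have -> : coord_pair (v + w) j = coord_pair v j + coord_pair w j.
    by apply/colP => i; rewrite !mxE.
  exact: RD.
move=> a v /(tensOP _ R_sub) Rv; apply/(tensOP _ R_sub) => j.
have -> : coord_pair (ofO a *: v) j = ofO a *: coord_pair v j.
  by apply/colP => i; rewrite !mxE.
exact: RZ.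
Qed.

Lemma tensO_bounded (R : set 'cV[K]_2) : is_submodule R ->
  submodule_bounded R -> submodule_bounded (@tensO p p_pr N R).
Proof.
move=> R_sub [d dN0 dP]; exists d => // w /(tensOP _ R_sub) Rw.
apply/integral_mxP => i j; rewrite {j}ord1 -(splitK i).
case: (fintype.split i) => j /=; have /integral_mxP dR := dP _ (Rw j).
  by have := dR 0 0; rewrite !mxE.
by have := dR 1 0; rewrite !mxE.
Qed.

Lemma tensO_absorbing (R : set 'cV[K]_2) : is_submodule R ->
  submodule_absorbing R -> submodule_absorbing (@tensO p p_pr N R).
Proof.
move=> R_sub [e eN0 eP]; exists e => // w /integral_mxP wO.
apply/(tensOP _ R_sub) => j.
have -> : coord_pair (ofO e *: w) j = ofO e *: coord_pair w j.
  by apply/colP => i; rewrite !mxE.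
by apply: eP; apply/integral_mxP => i k; rewrite mxE; exact: wO.
Qed.

Lemma tensO_scale (R : set 'cV[K]_2) (l : K) (w : 'cV[K]_(N + N)) :
  tensO R w -> tensO (scale_set l R) (l *: w).
Proof.
move=> [m [r [e [Rr ->]]]]; exists m, (fun i => l *: r i), e.
split=> [i|]; first by exists (r i).
rewrite scaler_sumr; apply: eq_bigr => i _.
by rewrite /tens scale_col_mx !scalerA !mxE.
Qed.

Lemma sub_tensO (R T : set 'cV[K]_2) :
  R `<=` T -> @tensO p p_pr N R `<=` @tensO p p_pr N T.
Proof.
move=> RT w [m [r [e [Rr ->]]]]; exists m, r, e; split=> // i.
exact/RT/Rr.
Qed.

(** This is the action of 1 (x) u: r (x) e goes to r (x) u e, and u e is again in O^N. *)
Lemma tensO_mulmx (R : set 'cV[K]_2) (u : 'M[O]_N) (y x : 'cV[K]_N) :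
  tensO R (col_mx y x) -> tensO R (col_mx (map_mx ofO u *m y) (map_mx ofO u *m x)).
Proof.
move=> [m [r [e [Rr yxE]]]]; exists m, r, (fun i => u *m e i); split=> //.
have -> (a b : 'cV[K]_N) : col_mx (map_mx ofO u *m a) (map_mx ofO u *m b) =
    block_mx (map_mx ofO u) 0 0 (map_mx ofO u) *m col_mx a b.
  by rewrite mul_block_col !mul0mx addr0 add0r.
rewrite yxE mulmx_sumr; apply: eq_bigr => i _.
by rewrite mul_block_col !mul0mx addr0 add0r map_mxM -!scalemxAr.
Qed.

End TensorLattice.

(** * Monotonicity, scaling and conjugation invariance of chi_g *)

Section CharacteristicSet.
Variables (alpha N : nat).
Implicit Types (g : 'M[K]_(alpha + N)) (R T : set 'cV[K]_2).

Lemma sub_chi g R T : R `<=` T -> chi g R `<=` chi g T.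
Proof.
move=> RT w [q [r [y [x [-> Ryx gE]]]]]; exists q, r, y, x; split=> //.
exact: sub_tensO Ryx.
Qed.

Lemma chi_scale g R (l : K) w : chi g R w -> chi g (scale_set l R) (l *: w).
Proof.
move=> [q [r [y [x [-> Ryx gE]]]]]; exists (l *: q), (l *: r), (l *: y), (l *: x).
rewrite -!scale_col_mx; split=> //; first exact: tensO_scale.
by rewrite gE scalemxAr.
Qed.

Lemma chi_scale_set g R (l : K) : l != 0 ->
  chi g (scale_set l R) = scale_set l (chi g R).
Proof.
move=> lN0; apply/seteqP; split=> [w wP|_ [w wP <-]]; last exact: chi_scale.
exists (l^-1 *: w); last by rewrite scalerA divff // scale1r.
(* The reverse inclusion is the direct one for l^-1, as l^-1 (l R) lies in R. *)
apply: sub_chi (chi_scale l^-1 wP) => _ [_ [v Rv <-] <-].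
by rewrite scalerA mulVf // scale1r.
Qed.

(** p chi_g(T) lies in chi_g(p T), hence in chi_g(R). *)
Lemma chi_arrow g R T : arrow R T -> arrow (chi g R) (chi g T).
Proof.
move=> [RT TR]; split; first exact: sub_chi.
by move=> _ [w Tw <-]; apply: sub_chi TR _ _; exact: chi_scale.
Qed.

Lemma diag_GLOM (u v : 'M[O]_N) :
  diag_GLO alpha u *m diag_GLO alpha v = diag_GLO alpha (u *m v).
Proof.
by rewrite /diag_GLO mulmx_block !mulmx0 !mul0mx !mulmx1 !addr0 !add0r map_mxM.
Qed.

Lemma diag_GLO1 : diag_GLO alpha (1%:M : 'M[O]_N) = 1%:M.
Proof. by rewrite /diag_GLO map_mx1 scalar_mx_block. Qed.

Lemma diag_GLO_unit (u : 'M[O]_N) : u \in unitmx ->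
  diag_GLO alpha u \in unitmx.
Proof.
move=> uU; apply: (proj1 (@mulmx1_unit _ _ _ (diag_GLO alpha (invmx u)) _)).
by rewrite diag_GLOM mulmxV // diag_GLO1.
Qed.

Lemma diag_GLO_inv (u : 'M[O]_N) : u \in unitmx ->
  invmx (diag_GLO alpha u) = diag_GLO alpha (invmx u).
Proof.
move=> uU; apply: (can_inj (mulKmx (diag_GLO_unit uU))).
by rewrite mulmxV ?diag_GLO_unit // diag_GLOM mulmxV // diag_GLO1.
Qed.

Lemma conjugate_GLO_sym g g' : conjugate_GLO g g' -> conjugate_GLO g' g.
Proof.
move=> [u uU ->]; exists (invmx u); first by rewrite unitmx_inv.
rewrite -diag_GLO_inv // invmxK -!mulmxA mulVmx ?diag_GLO_unit // mulmx1.
by rewrite mulmxA mulVmx ?diag_GLO_unit // mul1mx.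
Qed.

(** The same q and r are witnessed by (u y, u x). Symmetry of conjugacy then turns this inclusion
    into an equality. *)
Lemma conjugate_sub_chi g g' R : conjugate_GLO g g' -> chi g R `<=` chi g' R.
Proof.
move=> [u uU ->] _ [q [r [y [x [-> Ryx gE]]]]].
exists q, r, (map_mx ofO u *m y), (map_mx ofO u *m x).
split=> //; first exact: tensO_mulmx.
have diagE (a : 'cV[K]_alpha) (b : 'cV[K]_N) :
    col_mx a (map_mx ofO u *m b) = diag_GLO alpha u *m col_mx a b.
  by rewrite /diag_GLO mul_block_col !mul0mx mul1mx addr0 add0r.
by rewrite !diagE gE -!mulmxA mulKmx // diag_GLO_unit.
Qed.

Lemma conjugate_chi g g' R : conjugate_GLO g g' -> chi g' R = chi g R.
Proof.
move=> gg'; apply/seteqP; split; apply: conjugate_sub_chi => //.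
exact: conjugate_GLO_sym.
Qed.

Lemma chi_submodule g R : is_submodule R -> is_submodule (chi g R).
Proof.
move=> R_sub; have [R0 RD RZ] := R_sub.
have [t0 tD tZ] := tensO_submodule N R_sub; split.
- by exists 0, 0, 0, 0; rewrite !col_mx0 mulmx0.
- move=> _ _ [q [r [y [x [-> yx gE]]]]] [q' [r' [y' [x' [-> yx' gE']]]]].
  exists (q + q'), (r + r'), (y + y'), (x + x').
  rewrite -!add_col_mx; split=> //; first exact: tD.
  by rewrite gE gE' mulmxDr.
- move=> a _ [q [r [y [x [-> yx gE]]]]].
  exists (ofO a *: q), (ofO a *: r), (ofO a *: y), (ofO a *: x).
  rewrite -!scale_col_mx; split=> //; first exact: tZ.
  by rewrite gE scalemxAr.
Qed.

(** * Squeezing chi_g(R) when b is onto and c is injective *)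

Section FullRank.
Variable g : 'M[K]_(alpha + N).
Hypothesis g_full : full_rank_corners g.
Let a := ulsubmx g.
Let b := ursubmx g.
Let c := dlsubmx g.
Let d := drsubmx g.

Lemma ursubmx_right_inverse : exists b' : 'M[K]_(N, alpha), b *m b' = 1%:M.
Proof.
exists (pinvmx b); apply: mulmxVp.
by rewrite /row_free; case: g_full => ->.
Qed.

Lemma dlsubmx_left_inverse : exists c' : 'M[K]_(alpha, N), c' *m c = 1%:M.
Proof.
exists (pinvmx c); apply: mulVpmx.
by rewrite /row_full; case: g_full => _ ->.
Qed.

Lemma mul_corners (q r : 'cV[K]_alpha) (y x : 'cV[K]_N) :
  col_mx q y = g *m col_mx r x <-> q = a *m r + b *m x /\ y = c *m r + d *m x.
Proof.
rewrite -{1}[g]submxK mul_block_col; split=> [/eq_col_mx//|[-> ->]//].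
Qed.

Lemma chi_bounded R : is_submodule R ->
  submodule_bounded R -> submodule_bounded (chi g R).
Proof.
move=> R_sub /(tensO_bounded N R_sub)[e eN0 eP].
have [c' c'K] := dlsubmx_left_inverse.
(* [F] maps (y, x) to (q, r): substitute r = c' (y - d x) into q = a r + b x. *)
pose F := block_mx (a *m c') (b - a *m c' *m d)
                   (c') (- (c' *m d)).
have [f fN0 fP] := integral_mx_denom F.
exists (f * e); first exact: mulf_neq0.
move=> _ [q [r [y [x [-> Ryx /mul_corners[qE yE]]]]]].
have rE : r = c' *m (y - d *m x).
  by rewrite yE addrK mulmxA c'K mul1mx.
have -> : col_mx q r = F *m col_mx y x.
  rewrite /F mul_block_col qE [in LHS]rE mulNmx mulmxBr; congr col_mx.
    by rewrite mulmxBl mulmxBr -!mulmxA addrAC addrA.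
  by rewrite mulmxA.
rewrite rmorphM -scalerA scalemxAr scalemxAl.
exact: integral_mulmx (eP _ Ryx).
Qed.

Lemma chi_absorbing R : is_submodule R ->
  submodule_absorbing R -> submodule_absorbing (chi g R).
Proof.
move=> R_sub /(tensO_absorbing N R_sub)[e eN0 eP].
have [b' b'K] := ursubmx_right_inverse.
(* [G] maps (q, r) to one admissible (y, x): x = b' (q - a r) solves b x = q - a r, and then y = c r
   + d x. *)
pose G := block_mx (d *m b') (c - d *m b' *m a)
                   (b') (- (b' *m a)).
have [f fN0 fP] := integral_mx_denom G.
exists (e * f) => [|w wO]; first exact: mulf_neq0.
have := eP _ (integral_mulmx fP wO).
rewrite -scalemxAl scalerA -rmorphM scalemxAr; move: (_ *: w) => {wO}w.
rewrite -[w]vsubmxK; move: (usubmx w) (dsubmx w) => q r.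
(* The witnesses y and x are the two blocks of [G] applied to (q, r), read off from [Gw]. *)
rewrite mul_block_col => Gw; do 4 eexists; split; [by []|exact: Gw|].
apply/mul_corners; rewrite mulNmx; split.
  by rewrite mulmxBr !mulmxA b'K !mul1mx addrC subrK.
by rewrite mulmxBl mulmxBr !mulmxA addrCA.
Qed.

Lemma chi_lattice R : is_lattice R -> is_lattice (chi g R).
Proof.
move=> R_lat; have [R_sub _ _] := R_lat.
apply: bounded_absorbing_lattice; first exact: chi_submodule.
  exact/chi_bounded/lattice_bounded.
exact/chi_absorbing/lattice_absorbing.
Qed.

End FullRank.
End CharacteristicSet.
End Lattices.

Theorem proposition4p1 (p : nat) (p_pr : prime p) (alpha N : nat)
    (g : 'M[padic p_pr]_(alpha + N)) :
  [/\ full_rank_corners g ->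
        forall R : set 'cV[padic p_pr]_2, is_lattice R -> is_lattice (chi g R),
      forall R T : set 'cV[padic p_pr]_2, is_lattice R -> is_lattice T ->
        connected_by_arrow R T ->
        connected_by_arrow (chi g R) (chi g T) \/ chi g R = chi g T,
      forall g' : 'M[padic p_pr]_(alpha + N), conjugate_GLO g g' ->
        forall R : set 'cV[padic p_pr]_2, is_lattice R -> chi g' R = chi g R &
      forall (lambda : padic p_pr) (R : set 'cV[padic p_pr]_2),
        lambda != 0 -> is_lattice R ->
        chi g (scale_set lambda R) = scale_set lambda (chi g R)].
Proof.
split=> [g_full R|R T _ _|g' gg' R _|l R lN0 _].
- exact: chi_lattice.
- by case=> RT; left; [left|right]; exact: chi_arrow.
- exact: conjugate_chi.
- exact: chi_scale_set.
Qed.
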